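(* Let $\tau^s$ be the optimal value of the separation problem $\mathcal{P}^s$, and for $r\in\mathbb{N}$ let $\tau^s_r(\boldsymbol{y}^1,\boldsymbol{y}^2)$ be the optimal value of the moment relaxation $\mathcal{P}^s_r(\boldsymbol{y}^1,\boldsymbol{y}^2)$, where $\boldsymbol{y}^i$ is the moment sequence of the probability measure $\mu^i=\sum_{\boldsymbol{x}\in S_i}\mu^i_{\boldsymbol{x}}\delta_{\boldsymbol{x}}$ on $S_i$, $i=1,2$. If $\mu^i_{\boldsymbol{x}}>0$ for all $\boldsymbol{x}\in S_i$, $i=1,2$, then $$\tau^s_r(\boldsymbol{y}^1,\boldsymbol{y}^2)\uparrow\tau^s\quad\text{as } r \text{ increases},$$ and the convergence is finite; that is, the sequence $(\tau^s_r(\boldsymbol{y}^1,\boldsymbol{y}^2))_{r\in\mathbb{N}}$ is nondecreasing and there exists $r_0\in\mathbb{N}$ such that $\tau^s_r(\boldsymbol{y}^1,\boldsymbol{y}^2)=\tau^s$ for all $r\ge r_0$.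
   Context: Let $n\ge1$, $d\in\mathbb{N}$, $t=\binom{n+d}{d}$. For $\boldsymbol\gamma\in\mathbb{N}^n$ put $|\boldsymbol\gamma|=\gamma_1+\dots+\gamma_n$ and $\boldsymbol{x}^{\boldsymbol\gamma}=x_1^{\gamma_1}\cdots x_n^{\gamma_n}$. A polynomial $\theta(\boldsymbol{x})=\sum_{|\boldsymbol\gamma|\le d}\theta_{\boldsymbol\gamma}\boldsymbol{x}^{\boldsymbol\gamma}\in\mathbb{R}[\boldsymbol{x}]$ of degree at most $d$ is identified with its coefficient vector $\boldsymbol\theta=(\theta_{\boldsymbol\gamma})_{|\boldsymbol\gamma|\le d}\in\mathbb{R}^t$ (with $\theta_{\boldsymbol\gamma}=0$ for $|\boldsymbol\gamma|>d$). Let $\Theta\subset\mathbb{R}^t$, let $f:\Theta\to\mathbb{R}$ be an objective function (optimality criterion), and let $S_1,S_2\subset\mathbb{R}^n$ be finite (nonempty) sets. Separation problem $\mathcal{P}^s$: $\tau^s=\inf\{f(\boldsymbol\theta):\ \boldsymbol\theta\in\Theta,\ \theta(\boldsymbol{x})\ge0\ \forall\boldsymbol{x}\in S_1,\ -\theta(\boldsymbol{x})\ge0\ \forall\boldsymbol{x}\in S_2\}$. Measures and moments: for $i=1,2$, $\mu^i=\sum_{\boldsymbol{x}\in S_i}\mu^i_{\boldsymbol{x}}\delta_{\boldsymbol{x}}$ is a fixed probability measure on $S_i$ ($\delta_{\boldsymbol{x}}$ the Dirac measure at $\boldsymbol{x}$, $\mu^i_{\boldsymbol{x}}\ge0$,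 $\sum_{\boldsymbol{x}\in S_i}\mu^i_{\boldsymbol{x}}=1$), with moments $y^i_{\boldsymbol\alpha}=\sum_{\boldsymbol{x}\in S_i}\mu^i_{\boldsymbol{x}}\boldsymbol{x}^{\boldsymbol\alpha}$, $\boldsymbol\alpha\in\mathbb{N}^n$, and $\boldsymbol{y}^i=(y^i_{\boldsymbol\alpha})_{\boldsymbol\alpha\in\mathbb{N}^n}$. Localizing matrix: for $r\in\mathbb{N}$, $M_r(\boldsymbol\theta\boldsymbol{y}^i)$ is the $\binom{n+r}{r}\times\binom{n+r}{r}$ real symmetric matrix indexed by $\boldsymbol\alpha,\boldsymbol\beta\in\mathbb{N}^n$ with $|\boldsymbol\alpha|,|\boldsymbol\beta|\le r$, with entries $M_r(\boldsymbol\theta\boldsymbol{y}^i)(\boldsymbol\alpha,\boldsymbol\beta)=\sum_{\boldsymbol\gamma}\theta_{\boldsymbol\gamma}\,y^i_{\boldsymbol\alpha+\boldsymbol\beta+\boldsymbol\gamma}$. Moment relaxation $\mathcal{P}^s_r(\boldsymbol{y}^1,\boldsymbol{y}^2)$: $\tau^s_r(\boldsymbol{y}^1,\boldsymbol{y}^2)=\inf\{f(\boldsymbol\theta):\ \boldsymbol\theta\in\Theta,\ M_r(\boldsymbol\theta\boldsymbol{y}^1)\succeq0,\ M_r(-\boldsymbol\theta\boldsymbol{y}^2)\succeq0\}$, where $\succeq0$ means positive semidefinite. Infima are taken in $[-\infty,+\infty]$, with $\inf\emptyset=+\infty$. *)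

(* Defs.v *)
(* Points of R^n are row vectors, and infima in [-oo, +oo] are [ereal_inf],
   for which [ereal_inf set0 = +oo]. *)
From HB Require Import structures.
From mathcomp Require Export all_boot all_order all_algebra finmap.
From mathcomp Require Export mpoly.
From mathcomp Require Export classical_sets reals constructive_ereal ereal.

Set Implicit Arguments.
Unset Strict Implicit.
Unset Printing Implicit Defensive.

Import Order.TTheory GRing.Theory Num.Theory.

Local Open Scope ring_scope.
Local Open Scope classical_set_scope.

(* R^t with t = 'C(n + d, d): coefficient vectors indexed by the exponents
   [g] with |g| <= d, i.e. [mdeg g < d.+1]. *)
Definition coefvec (R : realType) (n d : nat) : Type :=
  {ffun 'X_{1..n < d.+1} -> R}.

HB.instance Definition _ (R : realType) (n d : nat) :=
  GRing.Zmodule.on (coefvec R n d).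

Definition poly_of (R : realType) (n d : nat) (theta : coefvec R n d) :
    {mpoly R[n]} :=
  \sum_(g : 'X_{1..n < d.+1}) theta g *: 'X_[g].

Definition eval (R : realType) (n d : nat) (theta : coefvec R n d)
    (x : 'rV[R]_n) : R :=
  (poly_of theta).@[fun i => x 0 i].

Definition monomial (R : realType) (n : nat) (x : 'rV[R]_n)
    (a : 'X_{1..n}) : R :=
  \prod_(i < n) x 0 i ^+ a i.

(* A measure \sum_(x in S) mu_x delta_x is represented by its weights mu_x. *)
Definition prob_weights (R : realType) (n : nat) (S : {fset 'rV[R]_n})
    (mu : S -> R) : Prop :=
  (forall x : S, 0 <= mu x) /\ \sum_(x : S) mu x = 1.

Definition moment (R : realType) (n : nat) (S : {fset 'rV[R]_n})
    (mu : S -> R) (a : 'X_{1..n}) : R :=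
  \sum_(x : S) mu x * monomial (val x) a.

(* The [i]-th exponent of degree at most [r]; it indexes rows and columns. *)
Definition expo (n r : nat) (i : 'I_#|{: 'X_{1..n < r.+1}}|) : 'X_{1..n} :=
  (enum_val i : 'X_{1..n < r.+1}).

Definition localizing (R : realType) (n d r : nat) (theta : coefvec R n d)
    (y : 'X_{1..n} -> R) : 'M[R]_#|{: 'X_{1..n < r.+1}}| :=
  \matrix_(i, j) \sum_(g : 'X_{1..n < d.+1})
    theta g * y (expo i + expo j + g)%MM.

Definition psd (R : realType) (k : nat) (M : 'M[R]_k) : Prop :=
  M^T = M /\ forall v : 'rV[R]_k, 0 <= (v *m M *m v^T) 0 0.

Definition sep_feasible (R : realType) (n d : nat)
    (Theta : set (coefvec R n d)) (S1 S2 : {fset 'rV[R]_n}) :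
    set (coefvec R n d) :=
  [set theta | [/\ Theta theta,
    forall x, x \in S1 -> 0 <= eval theta x &
    forall x, x \in S2 -> 0 <= - eval theta x]].

Definition relax_feasible (R : realType) (n d : nat)
    (Theta : set (coefvec R n d)) (y1 y2 : 'X_{1..n} -> R) (r : nat) :
    set (coefvec R n d) :=
  [set theta | [/\ Theta theta,
    psd (localizing r theta y1) &
    psd (localizing r (- theta) y2)]].

(* The values of the criterion [f] outside [Theta] are never used. *)
Definition tau_sep (R : realType) (n d : nat) (Theta : set (coefvec R n d))
    (f : coefvec R n d -> R) (S1 S2 : {fset 'rV[R]_n}) : \bar R :=
  ereal_inf [set (f theta)%:E | theta in sep_feasible Theta S1 S2].

Definition tau_relax (R : realType) (n d : nat) (Theta : set (coefvec R n d))
    (f : coefvec R n d -> R) (y1 y2 : 'X_{1..n} -> R) (r : nat) : \bar R :=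
  ereal_inf [set (f theta)%:E | theta in relax_feasible Theta y1 y2 r].

(* Main.v *)
From mathcomp Require Import ring.
Require Import Defs.

(** For the moment sequence [y] of a measure [mu] on a finite set [S], and for
    a polynomial [p] of degree at most [r] with coefficient vector [v], the
    quadratic form of the localizing matrix is an integral,
      [v M_r(theta y) v^T = \sum_(x in S) mu_x theta(x) p(x)^2],
    so [M_r(theta y)] is positive semidefinite exactly when this sum is
    nonnegative for all [p] of degree at most [r] ([psd_localizingP]).

    Three things follow from this.  The condition for a larger order implies
    the condition for a smaller one, because there are more test polynomials;
    so the feasible sets shrink and the infima grow with [r].  If
    [theta >= 0] on [S], every such sum is nonnegative, so each relaxation
    contains the separation problem.  Conversely, once [r] bounds the degrees
    of polynomials that vanish on all of [S] except at one given point [x],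
    testing with such a polynomial leaves the single term
    [mu_x theta(x) p(x)^2], and [mu_x > 0] gives [theta(x) >= 0]
    ([psd_localizing_eval_ge0]).  As [S] is finite, one order serves all its
    points, whatever [theta] is: from that order on the two problems have the
    same feasible set, and hence the same value. *)

Set Implicit Arguments.
Unset Strict Implicit.
Unset Printing Implicit Defensive.

Import Order.TTheory GRing.Theory Num.Theory.

Local Open Scope ring_scope.
Local Open Scope classical_set_scope.

Local Notation value p x := (meval (fun i => x 0 i) p).

Lemma monomialE (R : realType) (n : nat) (x : 'rV[R]_n) (a : 'X_{1..n}) :
  monomial x a = value 'X_[a] x.
Proof. by rewrite mevalX. Qed.

Lemma monomialD (R : realType) (n : nat) (x : 'rV[R]_n) (a b : 'X_{1..n}) :
  monomial x (a + b)%MM = monomial x a * monomial x b.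
Proof. by rewrite !monomialE mpolyXD mevalM. Qed.

Lemma evalE (R : realType) (n d : nat) (theta : coefvec R n d)
    (x : 'rV[R]_n) :
  eval theta x = \sum_(g : 'X_{1..n < d.+1}) theta g * monomial x g.
Proof.
rewrite /eval /poly_of raddf_sum; apply: eq_bigr => g _ /=.
by rewrite mevalZ monomialE.
Qed.

Lemma evalN (R : realType) (n d : nat) (theta : coefvec R n d)
    (x : 'rV[R]_n) :
  eval (- theta) x = - eval theta x.
Proof.
by rewrite !evalE -sumrN; apply: eq_bigr => g _; rewrite ffunE mulNr.
Qed.

Definition row_mpoly (R : realType) (n r : nat)
    (v : 'rV[R]_#|{: 'X_{1..n < r.+1}}|) : {mpoly R[n]} :=
  \sum_i v 0 i *: 'X_[expo i].

Lemma value_row_mpoly (R : realType) (n r : nat)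
    (v : 'rV[R]_#|{: 'X_{1..n < r.+1}}|) (x : 'rV[R]_n) :
  value (row_mpoly v) x = \sum_i v 0 i * monomial x (expo i).
Proof.
rewrite /row_mpoly raddf_sum; apply: eq_bigr => i _ /=.
by rewrite mevalZ monomialE.
Qed.

Lemma msize_row_mpoly (R : realType) (n r : nat)
    (v : 'rV[R]_#|{: 'X_{1..n < r.+1}}|) :
  (msize (row_mpoly v) <= r.+1)%N.
Proof.
apply: leq_trans (msize_sum _ _ _) _; apply/bigmax_leqP => i _.
by apply: leq_trans (msizeZ_le _ _) _; rewrite msizeX bmdeg.
Qed.

Lemma row_mpoly_surj (R : realType) (n r : nat) (p : {mpoly R[n]}) :
  (msize p <= r.+1)%N ->
  row_mpoly (\row_(i < #|{: 'X_{1..n < r.+1}}|) p@_(expo i)) = p.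
Proof.
move=> p_le; rewrite [RHS](mpolywE p_le) /row_mpoly.
under eq_bigr do rewrite mxE.
by rewrite -(big_enum_val (fun m : 'X_{1..n < r.+1} => p@_m *: 'X_[m])).
Qed.

(** The moments are integrals, so the localizing matrix is a linear
    combination of the rank-one matrices of the points of [S]. *)
Lemma localizing_momentE (R : realType) (n d r : nat)
    (theta : coefvec R n d) (S : {fset 'rV[R]_n}) (mu : S -> R) i j :
  localizing r theta (moment mu) i j =
  \sum_(x : S) mu x * eval theta (val x) *
    (monomial (val x) (expo i) * monomial (val x) (expo j)).
Proof.
rewrite mxE; under eq_bigr do rewrite mulr_sumr.
rewrite exchange_big; apply: eq_bigr => x _ /=.
rewrite evalE mulr_sumr mulr_suml; apply: eq_bigr => g _.
rewrite !monomialD; ring.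
Qed.

Lemma quad_localizing (R : realType) (n d r : nat)
    (theta : coefvec R n d) (S : {fset 'rV[R]_n}) (mu : S -> R)
    (v : 'rV[R]_#|{: 'X_{1..n < r.+1}}|) :
  (v *m localizing r theta (moment mu) *m v^T) 0 0 =
  \sum_(x : S) mu x * eval theta (val x) * value (row_mpoly v) (val x) ^+ 2.
Proof.
rewrite mxE.
under eq_bigr do rewrite !mxE mulr_suml.
under eq_bigr => j _ do under eq_bigr => i _ do
  rewrite localizing_momentE mulr_sumr mulr_suml.
under eq_bigr do rewrite exchange_big.
rewrite exchange_big; apply: eq_bigr => x _ /=.
(* [eval] unfolds to a sum: generalizing it keeps [mulr_sumr] off it. *)
rewrite value_row_mpoly; move: (eval _ _) => t.
rewrite expr2 big_distrlr mulr_sumr /=; apply: eq_bigr => j _.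
rewrite mulr_sumr; apply: eq_bigr => i _.
ring.
Qed.

Lemma psd_localizingP (R : realType) (n d r : nat)
    (theta : coefvec R n d) (S : {fset 'rV[R]_n}) (mu : S -> R) :
  psd (localizing r theta (moment mu)) <->
  forall p : {mpoly R[n]}, (msize p <= r.+1)%N ->
    0 <= \sum_(x : S) mu x * eval theta (val x) * value p (val x) ^+ 2.
Proof.
split=> [[_ quad_ge0] p p_le | int_ge0].
  by rewrite -(row_mpoly_surj p_le) -quad_localizing.
split=> [|v]; last by rewrite quad_localizing int_ge0 // msize_row_mpoly.
apply/matrixP => i j; rewrite mxE !localizing_momentE.
by apply: eq_bigr => x _; congr (_ * _); rewrite mulrC.
Qed.

Lemma psd_localizing_le (R : realType) (n d r s : nat)
    (theta : coefvec R n d) (S : {fset 'rV[R]_n}) (mu : S -> R) :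
  (r <= s)%N -> psd (localizing s theta (moment mu)) ->
  psd (localizing r theta (moment mu)).
Proof.
move=> le_rs /psd_localizingP int_ge0; apply/psd_localizingP => p p_le.
by apply: int_ge0; apply: leq_trans p_le _.
Qed.

Lemma eval_ge0_psd_localizing (R : realType) (n d r : nat)
    (theta : coefvec R n d) (S : {fset 'rV[R]_n}) (mu : S -> R) :
  (forall x, 0 <= mu x) -> (forall x, x \in S -> 0 <= eval theta x) ->
  psd (localizing r theta (moment mu)).
Proof.
move=> mu_ge0 theta_ge0; apply/psd_localizingP => p _; apply: sumr_ge0 => x _.
by rewrite mulr_ge0 ?sqr_ge0 // mulr_ge0 // theta_ge0 // fsvalP.
Qed.

Lemma value_sqdist (R : realType) (n : nat) (x y : 'rV[R]_n) :
  value (\sum_(i < n) ('X_i - (x 0 i)%:MP) ^+ 2) y =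
  \sum_(i < n) (y 0 i - x 0 i) ^+ 2.
Proof.
rewrite raddf_sum; apply: eq_bigr => i _ /=.
by rewrite rmorphXn /= mevalB mevalXU mevalC.
Qed.

(** Up to a scalar, an interpolation polynomial at [x]: the product of the
    squared distances to the other points of [S].  Squared distances spare the
    choice, for each other point, of a coordinate in which it differs from
    [x]. *)
Definition isolating_mpoly (R : realType) (n : nat) (S : {fset 'rV[R]_n})
    (x : S) : {mpoly R[n]} :=
  \prod_(y : S | y != x) \sum_(i < n) ('X_i - ((val y) 0 i)%:MP) ^+ 2.

Lemma value_isolating_eq0 (R : realType) (n : nat) (S : {fset 'rV[R]_n})
    (x y : S) :
  (value (isolating_mpoly x) (val y) == 0) = (y != x).
Proof.
rewrite /isolating_mpoly rmorph_prod /=.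
apply/idP/idP => [/prodf_eq0[z z_neq] | y_neq].
  rewrite value_sqdist psumr_eq0 => [/allP sq_eq0 | i _]; last exact: sqr_ge0.
  suff -> : y = z by [].
  apply/val_inj/rowP => i; apply/eqP.
  by rewrite -subr_eq0 -sqrf_eq0; apply: sq_eq0; apply: mem_index_enum.
apply/prodf_eq0; exists y => //.
by rewrite value_sqdist big1 // => i _; rewrite subrr expr0n.
Qed.

(** The isolating polynomials depend on [S] alone, hence an order that is
    uniform in [theta]; without this uniformity the equality of the feasible
    sets, and so of the infima, would not follow. *)
Lemma psd_localizing_eval_ge0 (R : realType) (n d : nat)
    (S : {fset 'rV[R]_n}) (mu : S -> R) :
  (forall x, 0 < mu x) ->
  exists r0 : nat, forall (r : nat) (theta : coefvec R n d), (r0 <= r)%N ->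
    psd (localizing r theta (moment mu)) ->
    forall x, x \in S -> 0 <= eval theta x.
Proof.
move=> mu_gt0; exists (\max_(x : S) msize (isolating_mpoly x))%N.
move=> r theta r0_le /psd_localizingP int_ge0 x xS; pose z : S := [` xS]%fset.
have z_le : (msize (isolating_mpoly z) <= r.+1)%N.
  apply: leqW; apply: leq_trans r0_le.
  exact: (leq_bigmax (F := fun x : S => msize (isolating_mpoly x)) z).
(* At the square of [isolating_mpoly z], only the term of [z] survives. *)
have := int_ge0 _ z_le; rewrite (bigD1 z) //= big1 ?addr0; last first.
  by move=> y; rewrite -value_isolating_eq0 => /eqP ->; rewrite expr0n mulr0.
rewrite pmulr_lge0 ?pmulr_rge0 //.
by rewrite lt0r sqr_ge0 sqrf_eq0 (value_isolating_eq0 z z) eqxx.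
Qed.

Theorem theorem1 (R : realType) (n d : nat) (n_ge1 : (1 <= n)%N)
    (Theta : set (coefvec R n d)) (f : coefvec R n d -> R)
    (S1 S2 : {fset 'rV[R]_n})
    (S1_neq0 : S1 != fset0%fset) (S2_neq0 : S2 != fset0%fset)
    (mu1 : S1 -> R) (mu2 : S2 -> R)
    (mu1_prob : prob_weights mu1) (mu2_prob : prob_weights mu2)
    (mu1_gt0 : forall x : S1, 0 < mu1 x)
    (mu2_gt0 : forall x : S2, 0 < mu2 x) :
  let tau_r := tau_relax Theta f (moment mu1) (moment mu2) in
  (forall r s : nat, (r <= s)%N -> (tau_r r <= tau_r s)%E) /\
  (exists r0 : nat, forall r : nat, (r0 <= r)%N ->
     tau_r r = tau_sep Theta f S1 S2).
Proof.
split=> [r s le_rs | ].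
  apply: ereal_inf_le_tmp; apply: image_subset => theta [in_Theta psd1 psd2].
  by split=> //; apply: psd_localizing_le le_rs _.
have [r1 ge0_S1] := psd_localizing_eval_ge0 d mu1_gt0.
have [r2 ge0_S2] := psd_localizing_eval_ge0 d mu2_gt0.
exists (maxn r1 r2) => r; rewrite geq_max => /andP[r1_le r2_le].
congr (ereal_inf (image _ _)); apply/seteqP.
split=> theta [in_Theta cond1 cond2]; split=> //.
- exact: ge0_S1 cond1.
- by move=> x xS; rewrite -evalN; apply: ge0_S2 cond2 _ xS.
- by apply: eval_ge0_psd_localizing => // x; apply: ltW.
- apply: eval_ge0_psd_localizing => x; first exact: ltW.
  by rewrite evalN; apply: cond2.
Qed.
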